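(* Let $\mathbb{F}_q$ be a finite field with $q$ elements, let $n\ge1$, let $w_1,\dots,w_n$ be positive integers, and let $X=\mathbb{P}(1,w_1,\dots,w_n)$ be the weighted projective space over $\overline{\mathbb{F}}_q$. Let $$Y_Q=\{[t_0:t_1^{w_1}:\cdots:t_n^{w_n}] : t_i\in\mathbb{F}_q^*\text{ for all } i=0,\dots,n\}$$ and $d_i=\frac{q-1}{\gcd(q-1,w_i)}$ for $i=1,\dots,n$. Let $\alpha\ge 0$ be an integer. Then the length of the code $\mathcal{C}_{\alpha,Y_Q}$ is $|Y_Q|=d_1\cdots d_n$, and its dimension is $$\dim(\mathcal{C}_{\alpha,Y_Q})=\sum_{m_n=0}^{\min\{\lfloor \frac{\alpha}{w_n}\rfloor,\,d_n-1\}}\ \sum_{m_{n-1}=0}^{\min\{\lfloor\frac{\alpha-m_nw_n}{w_{n-1}}\rfloor,\,d_{n-1}-1\}}\cdots\sum_{m_1=0}^{\min\{\lfloor\frac{\alpha-m_nw_n-\cdots-m_2w_2}{w_1}\rfloor,\,d_1-1\}}1.$$ Moreover, the $a$-invariant of $Y_Q$ is $$a_{Y_Q}=(d_1-1)w_1+\cdots+(d_n-1)w_n-1.$$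
   Context: Put $w_0=1$. Standing assumption on the weights: any $n$ of the integers $w_0,w_1,\dots,w_n$ have no common divisor greater than $1$. The weighted projective space is $\mathbb{P}(w_0,\dots,w_n)=(\overline{\mathbb{F}}_q^{\,n+1}\setminus\{0\})/G$ with $G=\{(\lambda^{w_0},\dots,\lambda^{w_n}):\lambda\in\overline{\mathbb{F}}_q^*\}$ acting by componentwise multiplication; $[p_0:\cdots:p_n]$ is the orbit of $(p_0,\dots,p_n)$. The ring $S=\mathbb{F}_q[x_0,\dots,x_n]$ is graded by $\deg x_i=w_i$, and $S_\alpha$ is the $\mathbb{F}_q$-vector space spanned by the monomials of degree $\alpha$. For a set $Y=\{P_1,\dots,P_N\}$ of $N$ distinct $\mathbb{F}_q$-rational points of $X$, each represented by a fixed vector of $\mathbb{F}_q^{n+1}$, the code $\mathcal{C}_{\alpha,Y}\subset\mathbb{F}_q^N$ is the image of the evaluation map $S_\alpha\to\mathbb{F}_q^N$, $F\mapsto(F(P_1),\dots,F(P_N))$. Its length is $N=|Y|$ and its dimension is its dimension as an $\mathbb{F}_q$-vector space (independent of the choice of representatives). The vanishing ideal $I(Y)\subset S$ is the ideal generated by all homogeneous polynomials vanishing at every point of $Y$, and $H_Y(\alpha)=\dim_{\mathbb{F}_q}S_\alpha-\dim_{\mathbb{F}_q}(I(Y)\cap S_\alpha)$. The Hilbert series can be written as $\sum_{\alpha\ge0}H_Y(\alpha)t^\alpha=\dfrac{p_{S/I(Y)}(t)}{(1-t^{w_0})\cdots(1-t^{w_n})}$ for a unique polynomial $p_{S/I(Y)}(t)$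 with integer coefficients, and the $a$-invariant of $Y$ is $a_Y=\deg(p_{S/I(Y)}(t))-w_0-\cdots-w_n$. *)

(* Defs.v *)
From HB Require Import structures.
From mathcomp Require Import all_boot all_order all_algebra all_field.
From mathcomp Require Import boolp classical_sets functions cardinality.
From mathcomp Require Import mpoly.

Set Implicit Arguments.
Unset Strict Implicit.
Unset Printing Implicit Defensive.

Import GRing.Theory.

Local Open Scope ring_scope.
Local Open Scope classical_set_scope.

(* Positivity of the weights is bundled because the graded pieces S_alpha
   below are finite dimensional only for positive weights. *)
Record weights (n : nat) := Weights {
  wt :> 'I_n.+1 -> nat;
  wt_gt0 : forall i, (0 < wt i)%N
}.

Definition well_formed n (w : weights n) : Prop :=
  forall (j : 'I_n.+1) (k : nat),
    (forall i, i != j -> (k %| w i)%N) -> (k <= 1)%N.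

Definition wdeg n (w : weights n) (m : 'X_{1..n.+1}) : nat :=
  (\sum_(i < n.+1) m i * w i)%N.

Lemma wdeg0 n (w : weights n) : wdeg w 0%MM = 0%N.
Proof. by apply: big1 => i _; rewrite mnm0E. Qed.

Lemma wdegD n (w : weights n) :
  {morph wdeg w : m1 m2 / (m1 + m2)%MM >-> (m1 + m2)%N}.
Proof.
by move=> m1 m2; rewrite -big_split; apply: eq_bigr => i _; rewrite mnmDE mulnDl.
Qed.

HB.instance Definition _ n (w : weights n) :=
  isMeasure.Build n.+1 (wdeg w) (wdeg0 w) (wdegD w).

Lemma leq_mdeg_wdeg n (w : weights n) m : (mdeg m <= wdeg w m)%N.
Proof. by rewrite mdegE; apply: leq_sum => i _; rewrite leq_pmulr ?wt_gt0. Qed.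

(* S_alpha, as a subtype of the polynomial ring: the analogue of the type
   mpoly.dhomog for the weighted degree. *)
Record graded_piece (F : fieldType) n (w : weights n) (alpha : nat) :=
  GradedPiece {
    poly_of_piece :> {mpoly F[n.+1]};
    _ : poly_of_piece \is alpha.-homog for (wdeg w)
  }.

Section GradedPieceTheory.
Context (F : fieldType) (n : nat) (w : weights n) (alpha : nat).
Notation S := (graded_piece F w alpha).

HB.instance Definition _ := [isSub for @poly_of_piece F n w alpha].
HB.instance Definition _ := [Choice of S by <:].
HB.instance Definition _ := [SubChoice_isSubLmodule of S by <:].

Lemma poly_of_piece_is_linear : linear (@poly_of_piece F n w alpha).
Proof. by []. Qed.

HB.instance Definition _ :=
  GRing.isLinear.Build F S {mpoly F[n.+1]} _ (@poly_of_piece F n w alpha)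
    poly_of_piece_is_linear.

Lemma graded_pieceP (p : S) : (p : {mpoly F[n.+1]}) \is alpha.-homog for (wdeg w).
Proof. by case: p. Qed.

Let monomials : pred 'X_{1..n.+1 < alpha.+1} := [pred m | wdeg w (val m) == alpha].
Let M (i : 'I_#|monomials|) : 'X_{1..n.+1} := val (enum_val i).

Lemma graded_piece_vecaxiom : vector_axiom #|monomials| S.
Proof.
pose f (p : S) := \row_(i < #|monomials|) (p : {mpoly F[n.+1]})@_(M i).
exists f => [c p q|].
  by apply/matrixP=> i j; rewrite !mxE /= mcoeffD mcoeffZ.
pose g (r : 'rV[F]_#|monomials|) : {mpoly F[n.+1]} :=
  \sum_i r 0 i *: 'X_[M i].
have dhg r : g r \is alpha.-homog for (wdeg w).
  apply: rpred_sum => i _; apply: rpredZ; rewrite dhomogX.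
  by have := enum_valP i.
have Minj : injective M by move=> i j /val_inj /enum_val_inj.
exists (fun r => GradedPiece (dhg r)) => [p|r].
  apply/val_inj/mpolyP => m /=; rewrite /g raddf_sum /=.
  have [mE|/eqP mN] := wdeg w m =P alpha.
    have mlt : (mdeg m < alpha.+1)%N by rewrite ltnS -mE leq_mdeg_wdeg.
    have mA : BMultinom mlt \in monomials by rewrite inE /= mE.
    have mM : M (enum_rank_in mA (BMultinom mlt)) = m.
      by rewrite /M enum_rankK_in.
    rewrite (bigD1 (enum_rank_in mA (BMultinom mlt))) //= mcoeffZ mcoeffX mM.
    rewrite eqxx mulr1 mxE mM big1 ?addr0 // => j jN.
    rewrite mcoeffZ mcoeffX; case: eqP => [jE|]; last by rewrite mulr0.
    by case/eqP: jN; apply: Minj; rewrite mM.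
  rewrite (dhomog_nemf_coeff (graded_pieceP p) mN) big1 // => i _.
  rewrite mcoeffZ mcoeffX; case: eqP => [iE|]; last by rewrite mulr0.
  by case/negP: mN; rewrite -iE; have := enum_valP i.
apply/rowP => j; rewrite mxE /= /g raddf_sum /= (bigD1 j) //= mcoeffZ mcoeffX.
rewrite eqxx mulr1 big1 ?addr0 // => i iN.
by rewrite mcoeffZ mcoeffX (inj_eq Minj) (negPf iN) mulr0.
Qed.

HB.instance Definition _ := Lmodule_hasFinDim.Build F S graded_piece_vecaxiom.

End GradedPieceTheory.

(* A point of the weighted projective space over L is the orbit, as a set of
   vectors, of a nonzero vector. *)
Definition wscale (L : fieldType) n (w : weights n) (lam : L)
    (v : 'rV[L]_n.+1) : 'rV[L]_n.+1 :=
  \row_i (lam ^+ w i * v 0 i).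

Definition worbit (L : fieldType) n (w : weights n) (v : 'rV[L]_n.+1) :
    set 'rV[L]_n.+1 :=
  [set wscale w lam v | lam in [set lam : L | lam != 0]].

Definition wproj (L : fieldType) n (w : weights n) : set (set 'rV[L]_n.+1) :=
  [set worbit w v | v in [set v : 'rV[L]_n.+1 | v != 0]].
Arguments wproj L {n} w.

Lemma vspace_of_set (F : fieldType) (V : vectType F) (A : set V) :
  A 0 -> (forall c u v, A u -> A v -> A (c *: u + v)) ->
  exists U : {vspace V}, forall v, v \in U <-> A v.
Proof.
move=> A0 Alin.
pose sub (U : {vspace V}) := forall v, v \in U -> A v.
pose d k := `[< exists2 U, sub U & \dim U = k >].
have [|k /asboolP[U _ <-]|k /asboolP[U subU Uk] kmax] := @ex_maxnP d (dim V).
- by exists 0%N; apply/asboolP; exists 0%VS; rewrite ?dimv0 // => v;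
    rewrite memv0 => /eqP->.
- by rewrite -dimvf dimvS ?subvf.
exists U => v; split=> [/subU //|Av].
suff /eqP-> : U == (U + <[v]>)%VS.
  exact: (subvP (addvSr U <[v]>%VS)) (memv_line v).
rewrite eqEdim addvSl /= Uk; apply: kmax; apply/asboolP.
exists (U + <[v]>)%VS => // _ /memv_addP[u uU [_ /vlineP[c ->] ->]].
by rewrite addrC; apply: Alin => //; apply: subU.
Qed.

Section Points.
Context (F : finFieldType) (L : closedFieldType) (iota : {rmorphism F -> L}).
Context (n : nat) (w : weights n).
Implicit Types (Y : set (set 'rV[L]_n.+1)) (alpha : nat).

Definition Fpoint (p : 'rV[F]_n.+1) : set 'rV[L]_n.+1 :=
  worbit w (map_mx iota p).

(* P_1, .., P_N is a repetition-free list of the points of Y, each given by a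
   chosen representative with coordinates in F. *)
Definition represents Y N (P : 'I_N -> 'rV[F]_n.+1) : Prop :=
  [/\ forall j, P j != 0,
      injective (fun j => Fpoint (P j)) &
      range (fun j => Fpoint (P j)) = Y].

(* The coordinate of index 0 is t_0 ^ w_0, that is t_0 once w_0 = 1. *)
Definition Y_Q : set (set 'rV[L]_n.+1) :=
  [set Fpoint (\row_i (t i ^+ w i))
     | t in [set t : 'I_n.+1 -> F | forall i, t i != 0]].

Lemma Y_Q_sub_wproj : Y_Q `<=` wproj L w.
Proof.
move=> _ [t /= tN0 <-]; exists (map_mx iota (\row_i (t i ^+ w i))) => //=.
apply/eqP => /rowP /(_ ord0); rewrite !mxE => /eqP.
by rewrite fmorph_eq0 expf_eq0 (negPf (tN0 _)) andbF.
Qed.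

Definition evalmap alpha N (P : 'I_N -> 'rV[F]_n.+1)
    (f : graded_piece F w alpha) : 'rV[F]_N :=
  \row_j (f : {mpoly F[n.+1]}).@[fun i => P j 0 i].

Lemma evalmap_is_linear alpha N (P : 'I_N -> 'rV[F]_n.+1) :
  linear (@evalmap alpha N P).
Proof. by move=> c f g; apply/rowP => j; rewrite !mxE /= mevalD mevalZ. Qed.

HB.instance Definition _ alpha N (P : 'I_N -> 'rV[F]_n.+1) :=
  GRing.isLinear.Build F (graded_piece F w alpha) 'rV[F]_N _
    (@evalmap alpha N P) (@evalmap_is_linear alpha N P).

Definition code alpha N (P : 'I_N -> 'rV[F]_n.+1) : {vspace 'rV[F]_N} :=
  limg (linfun (@evalmap alpha N P)).

Definition vanishes_on Y (f : {mpoly F[n.+1]}) : Prop :=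
  forall O, Y O -> forall v, O v -> (map_mpoly iota f).@[fun i => v 0 i] = 0.

Definition vanishing_generators Y : set {mpoly F[n.+1]} :=
  [set f | (exists e, f \is e.-homog for (wdeg w)) /\ vanishes_on Y f].

Definition vanishing_ideal Y : set {mpoly F[n.+1]} :=
  [set f | exists2 s : seq ({mpoly F[n.+1]} * {mpoly F[n.+1]}),
     (forall u, u \in s -> vanishing_generators Y u.2) &
     f = \sum_(u <- s) u.1 * u.2].

(* I(Y) :&: S_alpha; the choice is justified by ideal_pieceP. *)
Definition ideal_piece Y alpha : {vspace graded_piece F w alpha} :=
  xget 0%VS [set U : {vspace graded_piece F w alpha} |
    forall f, f \in U <-> vanishing_ideal Y f].

Definition hilbert_function Y alpha : nat :=
  (\dim {: graded_piece F w alpha} - \dim (ideal_piece Y alpha))%N.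

(* H_Y(a) t^a summed over a equals p(t) / \prod_i (1 - t^{w_i}): since the
   denominator is invertible as a power series, this is
   p(t) = (\sum_a H_Y(a) t^a) * \prod_i (1 - t^{w_i}) as formal power series,
   written coefficientwise. *)
Definition hilbert_numerator Y (p : {poly int}) : Prop :=
  forall k : nat,
    p`_k = \sum_(a < k.+1) (hilbert_function Y a)%:Z *
             (\prod_(i < n.+1) (1 - 'X^(w i)) : {poly int})`_(k - a).

(* The numerator is unique (hilbert_numerator_uniq). If there were none, the
   default 0 would give the value - (w_0 + .. + w_n) <= - 2 when n >= 1. *)
Definition a_invariant Y : int :=
  (size (xget 0 [set p | hilbert_numerator Y p])).-1%:Z
  - (\sum_(i < n.+1) w i)%N%:Z.

Lemma hilbert_numerator_uniq Y p q :
  hilbert_numerator Y p -> hilbert_numerator Y q -> p = q.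
Proof. by move=> pP qP; apply/polyP => k; rewrite pP qP. Qed.

Lemma ideal_pieceP Y alpha f :
  f \in ideal_piece Y alpha <-> vanishing_ideal Y f.
Proof.
apply: (xgetPex 0%VS (P := [set U : {vspace graded_piece F w alpha} |
  forall g, g \in U <-> vanishing_ideal Y g])).
apply: (vspace_of_set (A := [set g : graded_piece F w alpha |
  vanishing_ideal Y g])).
  by exists [::]; rewrite ?big_nil.
move=> c u v /= [s sY uE] [r rY vE].
exists ([seq (c *: x.1, x.2) | x <- s] ++ r) => [x|].
  by rewrite mem_cat => /orP[/mapP[y /sY ? ->]|/rY].
rewrite big_cat big_map /= uE vE scaler_sumr; congr (_ + _).
by apply: eq_bigr => x _; rewrite scalerAl.
Qed.

End Points.

Definition dQ (F : finFieldType) n (w : weights n) (i : 'I_n.+1) : nat :=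
  ((#|F| - 1) %/ gcdn (#|F| - 1) (w i))%N.

(* nested_sum w d k a = \sum_(m_k <= min (a / w_k) (d_k - 1))
     \sum_(m_{k-1} <= min ((a - m_k w_k) / w_{k-1}) (d_{k-1} - 1)) .. 1 *)
Fixpoint nested_sum (w d : nat -> nat) (k a : nat) : nat :=
  if k is k'.+1 then
    (\sum_(0 <= m < (minn (a %/ w k) (d k - 1)).+1)
       nested_sum w d k' (a - m * w k))%N
  else 1%N.

(* Main.v *)
(* Since w_0 = 1, every point of Y_Q has a unique representative (1, s) with
   s_i a d_i-th root of unity in F, because the w_i-th powers in the cyclic group
   F^* are exactly those roots; this gives |Y_Q|. On these representatives the
   monomials restrict to characters of the group of all s, so exponents only
   matter modulo d_i. The reduced monomials (m_i < d_i) are distinct characters,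
   hence linearly independent, and one of them occurs in degree alpha exactly
   when sum m_i w_i <= alpha; this gives the dimension.
   Counting reduced exponents by weighted degree, H_Y(alpha) is the sum of the
   coefficients of index at most alpha in
     prod_i (1 - t^(w_i d_i)) / (1 - t^(w_i)),
   so the numerator of the Hilbert series is prod_i (1 - t^(w_i d_i)), of degree
   sum w_i d_i. *)

Require Import Defs.
From HB Require Import structures.
From mathcomp Require Import all_boot all_order all_algebra all_field.
From mathcomp Require Import boolp classical_sets functions cardinality.
From mathcomp Require Import mpoly.
From mathcomp Require Import cyclic.

Set Implicit Arguments.
Unset Strict Implicit.
Unset Printing Implicit Defensive.

Import GRing.Theory.

Local Open Scope ring_scope.
Local Open Scope classical_set_scope.

(** * Generating functions for bounded exponents, graded by weighted degree *)

Definition trunc_geom (R : nzRingType) (w d : nat) : {poly R} :=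
  \sum_(m < d) 'X^(m * w).

Lemma trunc_geomE (R : comNzRingType) w d :
  trunc_geom R w d * (1 - 'X^w) = 1 - 'X^(w * d).
Proof.
rewrite exprM -[RHS]opprB subrX1 mulrC -mulNr opprB; congr (_ * _).
by apply: eq_bigr => i _; rewrite -exprM mulnC.
Qed.

(** Induction on [k]: fixing the outermost index [m] amounts to a factor ['X^(m * w k)], which
    shifts the coefficients and leaves the bound [a - m * w k] for the inner sums. *)
Lemma nested_sumE (R : comNzRingType) (w d : nat -> nat) k a :
  (forall i, 0 < w i)%N -> (forall i, 0 < d i)%N ->
  (nested_sum w d k a)%:R =
    \sum_(b < a.+1) (\prod_(i < k) trunc_geom R (w i.+1) (d i.+1))`_b.
Proof.
move=> w0 d0; elim: k a => [|k IH] a /=.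
  by rewrite big_ord0 big_ord_recl /= coefC big1 ?addr0 // => i _; rewrite coefC.
rewrite [RHS](eq_bigr (fun b : 'I_a.+1 => \sum_(m < d k.+1)
  if (b < m * w k.+1)%N then 0 else
    (\prod_(i < k) trunc_geom R (w i.+1) (d i.+1))`_(b - m * w k.+1))); last first.
  move=> b _; rewrite big_ord_recr /= /trunc_geom mulr_sumr coef_sum.
  by apply: eq_bigr => m _; rewrite coefMXn.
rewrite exchange_big /= natr_sum /= big_mkord.
set h := fun m : nat => (nested_sum w d k (a - m * w k.+1))%:R : R.
(* Positivity of [d k.+1] turns the inclusive bound [d k.+1 - 1] into the strict bound [d k.+1]. *)
rewrite (_ : (minn _ _).+1 = minn (a %/ w k.+1).+1 (d k.+1)); last first.
  by rewrite -minnSS -subSn // subSS subn0.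
rewrite (big_ord_widen (d k.+1) h) ?geq_minr // big_mkcond /=.
apply: eq_bigr => m _; rewrite leq_min ltn_ord andbT ltnS leq_divRL //.
case: leqP => mw; last first.
  rewrite big1 // => b _; case: ifP => // /negbT; rewrite -leqNgt => le.
  by have := leq_trans mw (leq_trans le (ltn_ord b : b <= a)%N); rewrite ltnn.
rewrite /h IH.
(* The range of [b] splits at the shift [m * w k.+1]: the terms below it are zero, the others are
   reindexed from 0. *)
have aE : a.+1 = (m * w k.+1 + (a - m * w k.+1).+1)%N by rewrite addnS subnKC.
set p := \prod_(i < k) _.
rewrite -(big_mkord xpredT (fun b => if (b < m * w k.+1)%N then 0 else
    p`_(b - m * w k.+1))) aE.
rewrite (big_cat_nat _ (n := m * w k.+1)) ?leq_addr //=.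
rewrite [X in X + _]big_nat_cond.
rewrite [X in _ = X + _]big1 => [|b]; last by rewrite andbT => /= ->.
rewrite add0r -[X in \sum_(X <= _ < _) _]add0n big_addn addKn big_mkord.
by apply: eq_bigr => b _; rewrite ltnNge leq_addl /= addnK.
Qed.

(** Expanding the product picks one exponent per coordinate, so each [f] in the box contributes one
    monomial, whose exponent is its weighted degree. The common bound [B] puts all exponents in one
    finite type. *)
Lemma card_box (R : comNzRingType) n B (w d : 'I_n -> nat) a :
  (forall i, d i <= B)%N ->
  #|[pred f : {ffun 'I_n -> 'I_B} | [forall i, (f i < d i)%N] &&
       (\sum_i f i * w i <= a)%N]|%:R =
    \sum_(b < a.+1) (\prod_i trunc_geom R (w i) (d i))`_b.
Proof.
move=> dB; rewrite (eq_bigr (fun i => \sum_(m < B | (m < d i)%N) 'X^(m * w i)));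
  last first.
  move=> i _; rewrite /trunc_geom.
  exact: (big_ord_widen _ (fun m => 'X^(m * w i))).
rewrite bigA_distr_big_dep /=.
under eq_bigr => b _ do rewrite coef_sum.
rewrite exchange_big /= -sum1_card natr_sum.
under eq_bigl => f do rewrite inE /=.
rewrite big_mkcondr /=; apply: eq_big => [f|f _].
  by apply: eq_forallb => i.
under [RHS]eq_bigr => b _ do rewrite prodrXr coefXn.
case: leqP => le_a; last first.
  rewrite big1 // => b _; case: eqP => // bE.
  by have := leq_trans (ltn_ord b) le_a; rewrite bE ltnn.
rewrite (bigD1 (Ordinal (le_a : _ < a.+1)%N)) //= eqxx big1 ?addr0 // => b bN.
by case: eqP => // bE; case/eqP: bN; apply: val_inj.
Qed.

(** Multiplication by [1 - 'X] undoes partial summation. This is how the denominator factor of the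
    weight-one variable gets absorbed. *)
Lemma convolution_partial_sums (R : comNzRingType) (G E : {poly R}) k :
  \sum_(a < k.+1) (\sum_(b < a.+1) G`_b) * ((1 - 'X) * E)`_(k - a) =
  (G * E)`_k.
Proof.
(* The series of partial sums is truncated to a polynomial; coefficients of index at most [k]
   suffice. *)
pose H := \poly_(a < k.+1) \sum_(b < a.+1) G`_b.
transitivity (H * ((1 - 'X) * E))`_k.
  by rewrite coefM; apply: eq_bigr => a _; rewrite coef_poly ltn_ord.
rewrite mulrA !coefM; apply: eq_bigr => -[j jk] _ /=; congr (_ * _).
rewrite mulrBr mulr1 coefB coefMX coef_poly jk; case: j jk => [|j] jk /=.
  by rewrite big_ord_recl big_ord0 addr0 subr0.
by rewrite coef_poly ltnW // big_ord_recr /= addrAC subrr add0r.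
Qed.

Lemma size_prod_1subXn (R : idomainType) n (m : 'I_n -> nat) :
  (forall i, 0 < m i)%N ->
  size (\prod_i (1 - 'X^(m i)) : {poly R}) = (\sum_i m i).+1.
Proof.
move=> m0.
have sz i : size (1 - 'X^(m i) : {poly R}) = (m i).+1.
  by rewrite -opprB size_polyN size_XnsubC.
rewrite size_prod => [|i _]; last by rewrite -size_poly_gt0 sz.
rewrite (eq_bigr (fun i => (m i + 1)%N)) => [|i _]; last by rewrite sz addn1.
by rewrite big_split /= sum1_card -addSn addnK.
Qed.

(** * Roots of unity in a finite field and their characters *)

Lemma expf_card_sub1 (F : finFieldType) (x : F) : x != 0 -> x ^+ (#|F| - 1) = 1.
Proof.
move=> x0; apply: (mulfI x0); rewrite -exprS mulr1 subn1 prednK ?expf_card //.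
exact: ltnW (finNzRing_gt1 F).
Qed.

Lemma finField_prim_root (F : finFieldType) :
  exists g : F, (#|F| - 1).-primitive_root g.
Proof.
have q_gt1 := finNzRing_gt1 F.
have [||||g _ g_prim] :=
  hasP (@has_prim_root F (#|F| - 1) (enum (predC1 0)) _ _ _ _).
- by rewrite subn_gt0.
- apply/allP => x; rewrite mem_enum inE => x0.
  by rewrite unity_rootE expf_card_sub1.
- exact: enum_uniq.
- by rewrite -cardE cardC1 subn1.
- by exists g.
Qed.

Section RootsOfUnity.
Context (F : finFieldType) (d : nat) (z : F) (z_prim : d.-primitive_root z).

Definition unity_pred (e : nat) : pred F := [pred s | s ^+ e == 1].

Lemma card_unity_pred : #|unity_pred d| = d.
Proof.
rewrite -[RHS]card_ord -(card_codom (f := fun i : 'I_d => z ^+ i)) => [|i j /eqP].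
  apply: eq_card => s; apply/eqP/codomP => [sd|[i ->]].
    by have [i ->] := prim_rootP z_prim sd; exists i.
  by rewrite exprAC (prim_expr_order z_prim) expr1n.
by rewrite (eq_prim_root_expr z_prim) !modn_small // => /eqP /val_inj.
Qed.

Lemma unity_pred_neq0 s : unity_pred d s -> s != 0.
Proof.
move=> /eqP sd; apply/eqP => s0; move/eqP: sd.
by rewrite s0 expr0n eqn0Ngt (prim_order_gt0 z_prim) eq_sym oner_eq0.
Qed.

Lemma sum_unity_pred m m' : (m < d)%N -> (m' < d)%N ->
  \sum_(s | unity_pred d s) s ^+ m / s ^+ m' = if m == m' then d%:R else 0.
Proof.
move=> md m'd; case: eqP => [->|/eqP mm'].
  rewrite -[in d%:R]card_unity_pred -sum1_card natr_sum.
  apply: eq_bigr => s /unity_pred_neq0 s0.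
  by rewrite divff // expf_neq0.
(* Multiplication by z permutes the roots of unity, so S is fixed under
   multiplication by z ^+ m / z ^+ m', which differs from 1. *)
set S := \sum_(s | _) _.
have z0 : z != 0 by apply/unity_pred_neq0/eqP/prim_expr_order.
have SE : S = z ^+ m / z ^+ m' * S.
  rewrite {1}/S (reindex_inj (mulfI z0)) mulr_sumr; apply: eq_big => s.
    by rewrite /unity_pred /= exprMn (prim_expr_order z_prim) mul1r.
  by rewrite !exprMn invfM mulrACA.
apply/eqP; move/eqP: SE; rewrite -subr_eq0 -{1}[S]mul1r -mulrBl mulf_eq0.
case/orP => //; rewrite subr_eq0 eq_sym => /eqP zE.
have : z ^+ m == z ^+ m'.
  by rewrite -[z ^+ m](divfK (expf_neq0 m' z0)) zE mul1r.
by rewrite (eq_prim_root_expr z_prim) !modn_small // (negPf mm').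
Qed.

End RootsOfUnity.

(** Multiplying the relation by the inverse character of [g] and summing over the group kills all
    other terms by orthogonality, leaving [c g] times the product of the [d i]. *)
Lemma unity_characters_free (F : finFieldType) n B (d : 'I_n -> nat)
    (z : 'I_n -> F) (A : pred {ffun 'I_n -> 'I_B})
    (c : {ffun 'I_n -> 'I_B} -> F) :
  (forall i, (d i).-primitive_root (z i)) ->
  (forall f, f \in A -> forall i, (f i < d i)%N) ->
  (forall s : {ffun 'I_n -> F}, (forall i, s i ^+ d i = 1) ->
     \sum_(f in A) c f * \prod_i s i ^+ f i = 0) ->
  forall f, f \in A -> c f = 0.
Proof.
move=> z_prim Ad c0 g gA.
pose G := family (fun i => @unity_pred F (d i)).
have : \sum_(s : {ffun 'I_n -> F} | s \in G)
    (\sum_(f in A) c f * \prod_i s i ^+ f i) * \prod_i (s i ^+ g i)^-1 = 0.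
  apply: big1 => s /familyP sG; rewrite c0 ?mul0r // => i.
  by apply/eqP; have := sG i.
under eq_bigr => s _ do rewrite mulr_suml.
rewrite exchange_big /=.
rewrite (eq_bigr (fun f =>
  c f * \prod_i if f i == g i :> nat then (d i)%:R else 0)); last first.
  move=> f fA; under eq_bigr => s _ do rewrite -mulrA -big_split /=.
  rewrite -mulr_sumr; congr (_ * _).
  rewrite -(bigA_distr_big_dep (fun i => @unity_pred F (d i))
    (fun i x => x ^+ f i / x ^+ g i)).
  by apply: eq_bigr => i _; rewrite (sum_unity_pred (z_prim i)) ?Ad.
(* Each [d i] is nonzero in [F] because a primitive [d i]-th root of unity exists there, so [c g]
   must vanish. *)
rewrite (bigD1 g) //= [X in _ + X]big1 ?addr0 => [/eqP|f /andP[fA fN]].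
  rewrite mulf_eq0 => /orP[/eqP //|/prodf_eq0[i _]].
  by rewrite eqxx (negPf (prim_root_natf_neq0 (z_prim i))).
have [i fi] : exists i, f i != g i.
  by apply/existsP; apply: contraNT fN => /existsPn H; apply/eqP/ffunP => i;
    apply/eqP; rewrite -[_ == _]negbK.
by rewrite (bigD1 i) //= val_eqE (negPf fi) mul0r mulr0.
Qed.

(** * Weighted scaling, evaluation and orbits *)

Lemma meval_wscale (K : fieldType) n (w : weights n) e (f : {mpoly K[n.+1]})
    (c : K) (v : 'rV[K]_n.+1) :
  f \is e.-homog for (wdeg w) ->
  f.@[wscale w c v 0] = c ^+ e * f.@[v 0].
Proof.
move=> /dhomogP f_hom; rewrite !mevalE mulr_sumr; apply: eq_big_seq => m mf.
rewrite mulrCA -(f_hom m mf); congr (_ * _).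
rewrite /= /wdeg -prodrXr -big_split /=; apply: eq_bigr => i _.
by rewrite mxE exprMn -exprM mulnC.
Qed.

Lemma meval_map_mpoly (F L : fieldType) (iota : {rmorphism F -> L}) n
    (f : {mpoly F[n]}) (v : 'rV[F]_n) :
  (map_mpoly iota f).@[map_mx iota v 0] = iota f.@[v 0].
Proof.
rewrite !mevalE (perm_big _ (msupp_map_mpoly _ (fmorph_inj iota))) rmorph_sum.
apply: eq_bigr => m _; rewrite mcoeff_map_mpoly rmorphM rmorph_prod.
by congr (_ * _); apply: eq_bigr => i _; rewrite mxE rmorphXn.
Qed.

Lemma wscale1 (K : fieldType) n (w : weights n) (v : 'rV[K]_n.+1) :
  wscale w 1 v = v.
Proof. by apply/rowP => i; rewrite mxE expr1n mul1r. Qed.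

Lemma wscaleA (K : fieldType) n (w : weights n) (b c : K) (v : 'rV[K]_n.+1) :
  wscale w b (wscale w c v) = wscale w (b * c) v.
Proof. by apply/rowP => i; rewrite !mxE exprMn mulrA. Qed.

Lemma map_wscale (F L : fieldType) (iota : {rmorphism F -> L}) n (w : weights n)
    (c : F) (v : 'rV[F]_n.+1) :
  map_mx iota (wscale w c v) = wscale w (iota c) (map_mx iota v).
Proof. by apply/rowP => i; rewrite !mxE rmorphM rmorphXn. Qed.

Lemma worbit_refl (L : fieldType) n (w : weights n) (v : 'rV[L]_n.+1) :
  worbit w v v.
Proof. by exists 1; rewrite /= ?oner_eq0 ?wscale1. Qed.

Lemma worbit_wscale (L : fieldType) n (w : weights n) (c : L)
    (v : 'rV[L]_n.+1) :
  c != 0 -> worbit w (wscale w c v) = worbit w v.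
Proof.
move=> c0; rewrite predeqE => u; split=> -[b /= b0 <-].
  by exists (b * c); rewrite ?wscaleA //= mulf_neq0.
by exists (b / c); rewrite ?wscaleA ?divfK //= mulf_neq0 ?invr_eq0.
Qed.

(** * Points of [Y_Q] parametrised by tuples of roots of unity *)

Section Torus.
Context (F : finFieldType) (n : nat) (w : weights n).
Context (w0 : w ord0 = 1%N).

(** The [w i]-th power of a generator of the cyclic group of units has order [dQ F w i]. *)
Lemma dQ_prim_root i : exists z : F, (dQ F w i).-primitive_root z.
Proof.
have [g g_prim] := finField_prim_root F.
by exists (g ^+ w i); rewrite /dQ gcdnC; apply: exp_prim_root.
Qed.

Lemma dQ_gt0 i : (0 < dQ F w i)%N.
Proof. by have [z /prim_order_gt0] := dQ_prim_root i. Qed.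

Lemma dQ_le_card i : (dQ F w i <= #|F|)%N.
Proof. exact: leq_trans (leq_div _ _) (leq_subr _ _). Qed.

Lemma unity_dQP i (s : F) :
  s ^+ dQ F w i = 1 <-> exists2 t, t != 0 & s = t ^+ w i.
Proof.
have [g g_prim] := finField_prim_root F.
have g0 : g != 0 by apply: (unity_pred_neq0 g_prim); apply/eqP/prim_expr_order.
split=> [sd|[t t0 ->]].
  have z_prim : (dQ F w i).-primitive_root (g ^+ w i).
    by rewrite /dQ gcdnC; apply: exp_prim_root.
  have [j ->] := prim_rootP z_prim sd.
  by exists (g ^+ j); rewrite ?expf_neq0 // exprAC.
(* The exponent [w i * dQ F w i] equals [#|F| - 1] times [w i] divided by the gcd. *)
rewrite -exprM /dQ muln_divA ?dvdn_gcdl // mulnC -muln_divA ?dvdn_gcdr //.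
by rewrite exprM expf_card_sub1 // expr1n.
Qed.

Definition torus_grid : pred {ffun 'I_n -> F} :=
  family (fun i => @unity_pred F (dQ F w (lift ord0 i))).

Lemma torus_gridP (s : {ffun 'I_n -> F}) :
  reflect (forall i, s i ^+ dQ F w (lift ord0 i) = 1) (s \in torus_grid).
Proof.
apply: (iffP familyP) => [H i|H i]; last exact/eqP/H.
by apply/eqP; have := H i.
Qed.

Lemma card_torus_grid : #|torus_grid| = (\prod_(i < n) dQ F w (lift ord0 i))%N.
Proof.
rewrite card_family foldrE big_map big_enum /=; apply: eq_bigr => i _.
by have [z z_prim] := dQ_prim_root (lift ord0 i); apply: (card_unity_pred z_prim).
Qed.

Definition affine_point (s : {ffun 'I_n -> F}) : 'rV[F]_n.+1 :=
  \row_i (if unlift ord0 i is Some k then s k else 1).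

Lemma affine_point0 s : affine_point s 0 ord0 = 1.
Proof. by rewrite mxE unlift_none. Qed.

Lemma affine_pointS s i : affine_point s 0 (lift ord0 i) = s i.
Proof. by rewrite mxE liftK. Qed.

Lemma affine_point_inj : injective affine_point.
Proof.
by move=> s t st; apply/ffunP => i; rewrite -!affine_pointS st.
Qed.

Lemma affine_point_neq0 s : affine_point s != 0.
Proof.
apply/eqP => /rowP /(_ ord0); rewrite affine_point0 mxE => /eqP.
by rewrite oner_eq0.
Qed.

Lemma meval_affine_point m s :
  'X_[m].@[affine_point s 0] = \prod_i s i ^+ m (lift ord0 i).
Proof.
rewrite /meval mmapX /mmap1 big_ord_recl affine_point0 expr1n mul1r.
by apply: eq_bigr => i _; rewrite affine_pointS.
Qed.

Context (L : closedFieldType) (iota : {rmorphism F -> L}).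
Local Notation Fpt := (Fpoint iota w).

Lemma Fpoint_wscale c v : c != 0 -> Fpt (wscale w c v) = Fpt v.
Proof. by move=> c0; rewrite /Fpoint map_wscale worbit_wscale ?fmorph_eq0. Qed.

(** The scaling factor a priori lies in [L]; coordinate 0, of weight 1 and value 1 at the affine
    point, identifies it with the image of [v 0 ord0]. *)
Lemma Fpoint_eq_affine s v : Fpt v = Fpt (affine_point s) ->
  v 0 ord0 != 0 /\ v = wscale w (v 0 ord0) (affine_point s).
Proof.
move=> vs; have := worbit_refl w (map_mx iota v).
rewrite -[worbit _ _]/(Fpt v) vs => -[c /= c0 cE].
have c_eq : c = iota (v 0 ord0).
  by have /rowP /(_ ord0) := cE; rewrite !mxE unlift_none w0 rmorph1 mulr1 expr1.
split; first by rewrite -(fmorph_eq0 iota) -c_eq.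
by apply: (map_mx_inj (f := iota)); rewrite map_wscale -c_eq cE.
Qed.

Lemma Fpoint_affine_inj : injective (fun s => Fpt (affine_point s)).
Proof.
move=> s t /Fpoint_eq_affine[_].
by rewrite affine_point0 wscale1 => /affine_point_inj.
Qed.

Lemma Y_Q_affine :
  Y_Q iota w = [set Fpt (affine_point s) | s in [set s | s \in torus_grid]].
Proof.
rewrite predeqE => O; split=> [[t /= t0 <-]|[s /= /torus_gridP sG <-]].
  (* Dividing all parameters by [t ord0] normalises the first coordinate to 1 within the orbit. *)
  exists [ffun i => (t (lift ord0 i) / t ord0) ^+ w (lift ord0 i)].
    apply/torus_gridP => i; rewrite ffunE; apply/unity_dQP.
    by exists (t (lift ord0 i) / t ord0); rewrite // mulf_neq0 ?invr_eq0.
  rewrite -(Fpoint_wscale _ (t0 ord0)); congr Fpoint; apply/rowP => i.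
  rewrite !mxE; case: unliftP => [k ->|->]; last by rewrite mulr1.
  by rewrite ffunE -exprMn mulrCA divff ?mulr1.
(* Conversely, choose [w]-th roots of the entries of [s] and take the parameter 1 at index 0. *)
have /choice[t tP] : forall i, exists t, t != 0 /\ s i = t ^+ w (lift ord0 i).
  by move=> i; have /unity_dQP[t] := sG i; exists t.
exists (fun i => if unlift ord0 i is Some k then t k else 1) => [i|] /=.
  by case: unliftP => [k _|_]; [case: (tP k)|rewrite oner_eq0].
congr Fpoint; apply/rowP => i; rewrite !mxE.
by case: unliftP => [k ->|->]; [case: (tP k)|rewrite expr1n].
Qed.

Definition torus_points (j : 'I_#|torus_grid|) : 'rV[F]_n.+1 :=
  affine_point (enum_val j).

Lemma torus_points_represent : represents iota w (Y_Q iota w) torus_points.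
Proof.
split=> [j|i j|].
- exact: affine_point_neq0.
- by move/Fpoint_affine_inj/enum_val_inj.
rewrite Y_Q_affine predeqE => O; split=> [[j _ <-]|[s /= sG <-]].
  by exists (enum_val j) => //=; apply: enum_valP.
by exists (enum_rank_in sG s); rewrite //= /torus_points enum_rankK_in.
Qed.

Lemma card_represents Y N (P : 'I_N -> 'rV[F]_n.+1) :
  represents iota w Y P -> (Y #= `I_N)%card.
Proof.
move=> [_ P_inj <-]; rewrite (card_eqr card_II).
have inj : {in setT &, injective (fun j => Fpt (P j))} by move=> i j _ _ /P_inj.
exact: inj_card_eq.
Qed.

Lemma card_Y_Q :
  (Y_Q iota w #= `I_(\prod_(i < n) dQ F w (lift ord0 i)))%card.
Proof.
by rewrite -card_torus_grid; apply: card_represents torus_points_represent.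
Qed.

Lemma represents_size N (P : 'I_N -> 'rV[F]_n.+1) :
  represents iota w (Y_Q iota w) P ->
  N = (\prod_(i < n) dQ F w (lift ord0 i))%N.
Proof.
move=> /card_represents YN; apply/card_eq_II.
by rewrite -(card_eql YN) card_Y_Q.
Qed.

(** Arbitrary representatives differ from the normalised ones only by scalings over [F], which
    multiply evaluations in a fixed degree by nonzero constants. *)
Lemma represents_affine N (P : 'I_N -> 'rV[F]_n.+1) :
  represents iota w (Y_Q iota w) P ->
  (forall j, exists2 s, s \in torus_grid &
     P j 0 ord0 != 0 /\ P j = wscale w (P j 0 ord0) (affine_point s)) /\
  (forall s, s \in torus_grid -> exists j,
     P j 0 ord0 != 0 /\ P j = wscale w (P j 0 ord0) (affine_point s)).
Proof.
rewrite Y_Q_affine => -[_ _ PY]; split=> [j|s sG].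
  have : [set Fpt (affine_point s) | s in [set s | s \in torus_grid]] (Fpt (P j)).
    by rewrite -PY; exists j.
  by move=> [s /= sG /esym /Fpoint_eq_affine]; exists s.
have : range (fun j => Fpt (P j)) (Fpt (affine_point s)) by rewrite PY; exists s.
by move=> [j _ /Fpoint_eq_affine]; exists j.
Qed.

(** * Reduced monomials, padded by a power of the weight-one variable *)

Local Notation d i := (dQ F w (lift ord0 i)).
Local Notation wS i := (w (lift ord0 i)).

(** The codomain ['I_#|F|] serves all coordinates at once, since every [d i] is at most [#|F|]. *)
Definition reduced_exponents (alpha : nat) : pred {ffun 'I_n -> 'I_#|F|} :=
  [pred f : {ffun 'I_n -> 'I_#|F|} | [forall i, (f i < d i)%N] &&
    (\sum_i f i * wS i <= alpha)%N].

Lemma reduced_exponentsP alpha (f : {ffun 'I_n -> 'I_#|F|}) :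
  reflect ((forall i, (f i < d i)%N) /\ (\sum_i f i * wS i <= alpha)%N)
    (f \in reduced_exponents alpha).
Proof. by apply: (iffP andP) => -[] /fintype.forallP. Qed.

(* The subtraction is truncated: the weighted degree is alpha only under
   \sum_k f k * wS k <= alpha. *)
Definition padded_exponents (alpha : nat) (f : {ffun 'I_n -> 'I_#|F|}) :
    'X_{1..n.+1} :=
  [multinom (if unlift ord0 i is Some k then val (f k)
             else alpha - \sum_k f k * wS k)%N | i < n.+1].

Lemma padded_exponentsS alpha (f : {ffun 'I_n -> 'I_#|F|}) i :
  padded_exponents alpha f (lift ord0 i) = f i.
Proof. by rewrite mnmE liftK. Qed.

Lemma wdeg_padded alpha (f : {ffun 'I_n -> 'I_#|F|}) :
  (\sum_i f i * wS i <= alpha)%N ->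
  wdeg w (padded_exponents alpha f) = alpha.
Proof.
move=> le; rewrite /wdeg big_ord_recl mnmE unlift_none w0 muln1.
under [in X in (_ + X)%N]eq_bigr => i _ do rewrite padded_exponentsS.
exact: subnK.
Qed.

(** The default 0 is taken exactly when the weighted degree of [f] exceeds [alpha], as padding then
    cannot reach degree [alpha]. *)
Definition reduced_monomial alpha (f : {ffun 'I_n -> 'I_#|F|}) :
    graded_piece F w alpha :=
  insubd 0 'X_[padded_exponents alpha f].

Lemma reduced_monomialE alpha (f : {ffun 'I_n -> 'I_#|F|}) :
  (\sum_i f i * wS i <= alpha)%N ->
  reduced_monomial alpha f = 'X_[padded_exponents alpha f] :> {mpoly F[n.+1]}.
Proof.
by move=> le; rewrite [LHS]val_insubd dhomogX /= wdeg_padded // eqxx.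
Qed.

Lemma meval_wscale_affine alpha (f : graded_piece F w alpha) c s :
  (f : {mpoly F[n.+1]}).@[wscale w c (affine_point s) 0] =
  c ^+ alpha * (f : {mpoly F[n.+1]}).@[affine_point s 0].
Proof. exact/meval_wscale/graded_pieceP. Qed.

(** * Dimension of the code and its link with the Hilbert function *)

Section Code.
Context (N : nat) (P : 'I_N -> 'rV[F]_n.+1).
Context (P_rep : represents iota w (Y_Q iota w) P).

Local Notation ev alpha := (linfun (@evalmap F n w alpha N P)).

Lemma evalmap_eq alpha (f g : graded_piece F w alpha) :
  (forall s, s \in torus_grid ->
     (f : {mpoly F[n.+1]}).@[affine_point s 0] =
     (g : {mpoly F[n.+1]}).@[affine_point s 0]) <->
  ev alpha f = ev alpha g.
Proof.
rewrite !lfunE /=; have [P_affine affine_P] := represents_affine P_rep.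
split=> [fg|/rowP fg s sG].
  apply/rowP => j; rewrite !mxE; have [s sG [c0 ->]] := P_affine j.
  by rewrite !meval_wscale_affine fg.
have [j [c0 Pj]] := affine_P s sG; have := fg j.
rewrite !mxE Pj !meval_wscale_affine.
by apply: mulfI; rewrite expf_neq0.
Qed.

(** The evaluations of the reduced monomials form a basis: independence of characters gives
    freeness, and reduction of exponents modulo the [d i] gives generation. *)
Lemma dim_code alpha : \dim (code w alpha P) = #|reduced_exponents alpha|.
Proof.
pose R := reduced_exponents alpha.
pose v (f : {ffun 'I_n -> 'I_#|F|}) := ev alpha (reduced_monomial alpha f).
pose X := [tuple v (enum_val i) | i < #|R|].
have z_ex i : exists z : F, (d i).-primitive_root z by apply: dQ_prim_root.
have {z_ex}/choice[z z_prim] := z_ex.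
have X_free : free X.
  apply/freeP => k k0 i.
  (* The coefficients [k] are transported to exponent functions; the index [i] supplies the member
     of [R] that [enum_rank_in] needs. Only values on [R] matter. *)
  pose c (f : {ffun 'I_n -> 'I_#|F|}) := k (enum_rank_in (enum_valP i) f).
  have ck j : c (enum_val j) = k j by rewrite /c enum_valK_in.
  rewrite -ck; apply: (unity_characters_free (A := R) z_prim) (enum_valP i).
    by move=> f /reduced_exponentsP[].
  move=> s /torus_gridP sG.
  have : ev alpha (\sum_(f in R) c f *: reduced_monomial alpha f) = ev alpha 0.
    rewrite linear0 -k0 linear_sum big_enum_val; apply: eq_bigr => j _.
    by rewrite linearZ /= ck nth_mktuple.
  move/evalmap_eq/(_ s sG); rewrite /= meval0 !raddf_sum => E; rewrite -[RHS]E.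
  apply: eq_bigr => f /reduced_exponentsP[_ le].
  rewrite [RHS](mevalZ (affine_point s 0) (c f) (reduced_monomial alpha f)).
  rewrite reduced_monomialE // meval_affine_point.
  by congr (_ * _); apply: eq_bigr => j _; rewrite padded_exponentsS.
have X_span : <<X>>%VS = code w alpha P.
  apply/vspaceP => u; apply/idP/idP => [|/memv_imgP[f _ ->]].
    move: u; apply/subvP/span_subvP => _ /mapP[j _ ->].
    by rewrite memv_img ?memvf.
  (* Exponents of the variables other than the first are reduced modulo [d i]. This cannot raise
     their weighted degree, so padding restores degree [alpha]. *)
  pose r (m : 'X_{1..n.+1}) : {ffun 'I_n -> 'I_#|F|} :=
    [ffun i => Ordinal (leq_trans (ltn_pmod (m (lift ord0 i)) (dQ_gt0 _))
                                  (dQ_le_card (lift ord0 i)))].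
  have rR m : m \in msupp f -> r m \in R.
    move=> mf; apply/reduced_exponentsP; split=> [i|].
      by rewrite ffunE ltn_pmod ?dQ_gt0.
    have /dhomogP /(_ m mf) /= <- := graded_pieceP f.
    rewrite /wdeg big_ord_recl; apply: leq_trans (leq_addl _ _).
    by apply: leq_sum => i _; rewrite ffunE leq_mul2r leq_mod orbT.
  (* On the grid [s i ^+ d i = 1] and the first coordinate is 1, so neither reduction nor padding
     changes values. *)
  have -> : ev alpha f =
      ev alpha (\sum_(m <- msupp f) f@_m *: reduced_monomial alpha (r m)).
    apply/evalmap_eq => s /torus_gridP sG.
    rewrite [in LHS](mpolyE f) !raddf_sum; apply: eq_big_seq => m mf.
    have /reduced_exponentsP[_ le] := rR m mf.
    rewrite [RHS](mevalZ (affine_point s 0) f@_m (reduced_monomial alpha (r m))).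
    rewrite [LHS]mevalZ reduced_monomialE // !meval_affine_point.
    congr (_ * _); apply: eq_bigr => j _.
    by rewrite padded_exponentsS ffunE /= expr_mod.
  rewrite linear_sum big_seq; apply: rpred_sum => m mf.
  rewrite linearZ; apply/memvZ/memv_span/codomP.
  by exists (enum_rank_in (rR m mf) (r m)); rewrite enum_rankK_in ?rR.
by rewrite -X_span -[RHS](size_tuple X); apply/eqP; rewrite -/(free X).
Qed.

(** Homogeneity reduces vanishing on a whole orbit over [L] to vanishing at one representative, and
    injectivity of [iota] brings this back to [F]. *)
Lemma evalmap_vanishes alpha (f : graded_piece F w alpha) :
  evalmap P f = 0 <-> vanishes_on iota (Y_Q iota w) f.
Proof.
have [_ _ <-] := P_rep; split=> [/rowP f0 _ [j _ <-] _ [lam _ <-]|f0].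
  have := f0 j; rewrite !mxE -[X in meval X]/(P j 0) => fj.
  rewrite -[X in meval X]/(wscale w lam (map_mx iota (P j)) 0).
  rewrite (meval_wscale (e := alpha)); last first.
    apply/dhomogP => m; rewrite (perm_mem (msupp_map_mpoly _ (fmorph_inj iota))).
    exact/dhomogP/graded_pieceP.
  by rewrite meval_map_mpoly fj rmorph0 mulr0.
apply/rowP => j; rewrite !mxE; apply: (fmorph_inj iota).
rewrite -[X in meval X]/(P j 0) -meval_map_mpoly rmorph0.
by apply: (f0 (Fpt (P j))) (worbit_refl _ _); exists j.
Qed.

(** A homogeneous polynomial vanishing on [Y] is itself a generator of the ideal. *)
Lemma vanishing_ideal_piece Y alpha (f : graded_piece F w alpha) :
  vanishing_ideal iota w Y f <-> vanishes_on iota Y f.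
Proof.
split=> [[s sY ->] O YO v Ov|f0].
  rewrite (rmorph_sum (map_mpoly iota)) /= (rmorph_sum (meval _)).
  rewrite big_seq big1 // => u us.
  have [_ /(_ O YO v Ov) u0] := sY u us.
  by rewrite rmorphM /= mevalM u0 mulr0.
exists [:: (1, f : {mpoly F[n.+1]})]; last by rewrite big_seq1 mul1r.
by move=> u; rewrite inE => /eqP -> /=; split=> //; exists alpha;
  apply: graded_pieceP.
Qed.

(** The degree [alpha] piece of the ideal is the kernel of evaluation, so rank-nullity applies. *)
Lemma hilbert_function_code alpha :
  hilbert_function iota w (Y_Q iota w) alpha = \dim (code w alpha P).
Proof.
rewrite /hilbert_function.
have -> : ideal_piece iota w (Y_Q iota w) alpha = lker (ev alpha).
  apply/vspaceP => f; apply/idP/idP; rewrite memv_ker lfunE.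
    by move/ideal_pieceP/vanishing_ideal_piece/evalmap_vanishes/eqP.
  by move/eqP/evalmap_vanishes/vanishing_ideal_piece/ideal_pieceP.
by rewrite -(limg_ker_dim (ev alpha)) capfv addKn.
Qed.

End Code.

(** * Counting reduced exponents, Hilbert numerator and a-invariant *)

Lemma card_reduced_exponents (R : comNzRingType) alpha :
  #|reduced_exponents alpha|%:R =
    \sum_(b < alpha.+1) (\prod_(i < n) trunc_geom R (wS i) (d i))`_b.
Proof. by rewrite card_box // => i; apply: dQ_le_card. Qed.

(** Both sides are the same partial sum of coefficients, compared in [int], where the cast from
    [nat] is injective. *)
Lemma card_reduced_nested alpha :
  #|reduced_exponents alpha| =
    nested_sum (fun k => w (inord k)) (fun k => dQ F w (inord k)) n alpha.
Proof.
apply/eqP; rewrite -eqz_nat -!natz card_reduced_exponents nested_sumE.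
- apply/eqP; apply: eq_bigr => b _; congr ((polyseq _)`__).
  apply: eq_bigr => i _; have -> // : inord i.+1 = lift ord0 i :> 'I_n.+1.
  by apply: val_inj; rewrite /= inordK // ltnS.
- by move=> i; apply: wt_gt0.
- by move=> i; apply: dQ_gt0.
Qed.

(** The factor [1 - 'X] from weight 1 cancels the partial sums in the Hilbert function; every other
    [1 - 'X^(wS i)] completes a truncated geometric sum to [1 - 'X^(wS i * d i)]. *)
Lemma hilbert_numerator_Y_Q :
  hilbert_numerator iota w (Y_Q iota w) (\prod_(i < n) (1 - 'X^(wS i * d i))).
Proof.
move=> k; rewrite big_ord_recl w0 expr1.
under eq_bigr => i _ do rewrite -trunc_geomE.
rewrite big_split -convolution_partial_sums; apply: eq_bigr => a _.
congr (_ * _).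
by rewrite (hilbert_function_code torus_points_represent)
  (dim_code torus_points_represent) -card_reduced_exponents natz.
Qed.

Lemma a_invariant_Y_Q :
  a_invariant iota w (Y_Q iota w) = (\sum_(i < n) (d i - 1) * wS i)%N%:Z - 1.
Proof.
(* Uniqueness forces the chosen numerator to be this product, of degree the sum of the
   [wS i * d i]. *)
rewrite /a_invariant (xget_unique _ hilbert_numerator_Y_Q); last first.
  by move=> p /hilbert_numerator_uniq; apply; apply: hilbert_numerator_Y_Q.
rewrite size_prod_1subXn => [|i]; last by rewrite muln_gt0 wt_gt0 dQ_gt0.
rewrite /= big_ord_recl w0 PoszD opprD addrCA addrC; congr (_ + _).
have -> : (\sum_(i < n) wS i * d i)%N =
    (\sum_(i < n) (d i - 1) * wS i + \sum_(i < n) wS i)%N.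
  rewrite -big_split; apply: eq_bigr => i _ /=.
  by rewrite mulnC -[in LHS](subnK (dQ_gt0 (lift ord0 i))) mulnDl mul1n.
by rewrite PoszD addrK.
Qed.

End Torus.

Theorem theorem4p1
  (F : finFieldType) (L : closedFieldType) (iota : {rmorphism F -> L})
  (L_algebraic : integralRange iota)
  (n : nat) (n_ge1 : (1 <= n)%N)
  (w : weights n) (w0 : w ord0 = 1%N) (w_wf : well_formed w) :
  [/\ (Y_Q iota w #= `I_(\prod_(i < n) dQ F w (lift ord0 i)))%card,
      forall (alpha N : nat) (P : 'I_N -> 'rV[F]_n.+1),
        represents iota w (Y_Q iota w) P ->
        N = (\prod_(i < n) dQ F w (lift ord0 i))%N /\
        \dim (code w alpha P) =
          nested_sum (fun k => w (inord k)) (fun k => dQ F w (inord k)) n alpha &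
      a_invariant iota w (Y_Q iota w) =
        (\sum_(i < n) (dQ F w (lift ord0 i) - 1) * w (lift ord0 i))%N%:Z - 1].
Proof.
split; [exact: card_Y_Q| |exact: a_invariant_Y_Q].
move=> alpha N P P_rep; split; first exact: represents_size P_rep.
by rewrite (dim_code w0 P_rep) card_reduced_nested.
Qed.
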